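(* The tail order $\preceq$ is not total when restricted to probability measures with compact support in $[0,\infty)$ and unimodal $C^\infty$ densities; that is, there exist two such measures $\mu_1,\mu_2$ for which neither $\mu_1\preceq\mu_2$ nor $\mu_2\preceq\mu_1$ holds.
   Context: $\mathbb{N}=\{0,1,2,\dots\}$. For a finite positive Borel measure $\mu$ on $[0,\infty)$ all of whose moments $s_n(\mu)=\int_0^\infty t^n\,d\mu(t)$, $n\in\mathbb{N}$, exist, the tail relation is defined by: $\mu_1\preceq\mu_2$ if and only if there is $n_0\in\mathbb{N}$ such that $s_n(\mu_1)\le s_n(\mu_2)$ for all $n\ge n_0$. Densities are with respect to Lebesgue measure and are $C^\infty$ functions on $\mathbb{R}$. A density is unimodal if it is continuous, has compact support and has one unique local maximum, where only points at which the density is positive are counted as local maxima (points where the density vanishes are disregarded). *)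

(* Defs.v *)
(* MathComp-Analysis, over an arbitrary [R : realType].

   Borel measures on [0, +oo) are represented as Borel measures on R that
   vanish on ]-oo, 0[. *)
From mathcomp Require Import all_boot all_order all_algebra.
From mathcomp Require Import all_classical all_reals all_analysis.
Import Order.TTheory GRing.Theory Num.Theory.
Import numFieldNormedType.Exports.

Set Implicit Arguments.
Unset Strict Implicit.
Unset Printing Implicit Defensive.

Local Open Scope classical_set_scope.
Local Open Scope ring_scope.

(* [+oo] when the moment diverges, since the integrand is nonnegative. *)
Definition moment (R : realType)
    (mu : {finite_measure set (measurableTypeR R) -> \bar R}) (n : nat) : \bar R :=
  (\int[mu]_(t in `[0%R, +oo[%classic) (t ^+ n)%:E)%E.

(* The domain of the tail order. *)
Definition tail_domain (R : realType)
    (mu : {finite_measure set (measurableTypeR R) -> \bar R}) : Prop :=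
  mu `]-oo, 0%R[%classic = 0%E /\
  forall n : nat,
    mu.-integrable `[0%R, +oo[%classic (fun t : measurableTypeR R => (t ^+ n)%:E).

Definition tail_le (R : realType)
    (mu1 mu2 : {finite_measure set (measurableTypeR R) -> \bar R}) : Prop :=
  exists n0 : nat, forall n : nat, (n0 <= n)%N ->
    (moment mu1 n <= moment mu2 n)%E.

Definition measure_support (R : realType)
    (mu : {finite_measure set (measurableTypeR R) -> \bar R}) : set R :=
  [set x : R | forall U : set R, open U -> U x -> (0 < mu U)%E].

Definition is_density (R : realType)
    (mu : {finite_measure set (measurableTypeR R) -> \bar R}) (f : R -> R) : Prop :=
  [/\ measurable_fun [set: R] f,
      (forall x : R, 0 <= f x) &
      forall A : set (measurableTypeR R), measurable A ->
        mu A = (\int[lebesgue_measure]_(x in A) (f x)%:E)%E].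

Definition smooth (R : realType) (f : R -> R) : Prop :=
  forall (n : nat) (x : R), derivable (derive1n n f) x 1.

(* Local maxima are non-strict, so a positive plateau contradicts uniqueness. *)
Definition local_max (R : realType) (f : R -> R) (x : R) : Prop :=
  \forall y \near x, f y <= f x.

Definition unimodal (R : realType) (f : R -> R) : Prop :=
  [/\ continuous f,
      compact (closure [set x : R | f x != 0]) &
      exists! x : R, 0 < f x /\ local_max f x].

Definition smooth_unimodal_measure (R : realType)
    (mu : {finite_measure set (measurableTypeR R) -> \bar R}) : Prop :=
  [/\ tail_domain mu,
      compact (measure_support mu),
      measure_support mu `<=` `[0, +oo[%classic &
      exists f : R -> R, [/\ is_density mu f, smooth f & unimodal f]].

(* Main.v *)
From HB Require Import structures.
Require Import Defs.
From mathcomp Require Import all_boot all_order all_algebra.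
From mathcomp Require Import all_classical all_reals all_analysis.
From mathcomp Require Import measurable_realfun ring lra.
Import Order.TTheory GRing.Theory Num.Theory.
Import numFieldNormedType.Exports.

Set Implicit Arguments.
Unset Strict Implicit.
Unset Printing Implicit Defensive.

Local Open Scope classical_set_scope.
Local Open Scope ring_scope.

(** Let [flat_bump w] be the smooth bump [exp (-1/(w - (x - 1)^2))], supported
    in [|x - 1| <= sqrt w].  Both measures have a density proportional to a
    series [mix w u = sum_k u_k * flat_bump w_k] of such bumps with the common
    centre [1], where [w_k = r_k^2] and the radii [r_k] increase to [1].

    - Unimodality costs nothing: every term is a nonincreasing function of
      [|x - 1|], so the sum is too, and it is strictly decreasing up to distance
      [1] because infinitely many [u_k] are positive
      ([unimodal_of_decreasing]).
    - Smoothness only asks that the [u_k] be small enough: a diagonal choice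
      makes the series of [m]-th derivatives geometrically small for every [m]
      at once, and the series may then be differentiated term by term
      ([smooth_mix]).
    - Neither measure dominates: the term of index [k + 1] is the first one to
      charge points beyond [b_k = 1 + r_k].  One density uses the terms [k + 1]
      with [k] even, the other those with [k] odd.  Fix [k]; the measure owning the
      term [k + 1] has an [n]-th moment at least of order [a_k^n], for some
      [a_k > b_k], whereas the other measure contributes at most [b_k^n] below
      [b_k], and at most [2^n] times its mass beyond [b_k], which comes from
      the terms of index larger than [k + 1] only.  Choosing first [n = n_k]
      large, then all later coefficients small compared with [2^-n], makes the
      owner win at [n_k] ([greedy_weights], [moment_lt]).  Since the owner
      alternates with the parity of [k] and [n_k >= k], each of the two moment
      sequences exceeds the other one infinitely often.

    The normalizing constants of the two densities do not disturb this
    comparison: the two mixtures share the term of index [0], hence both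
    constants lie in an interval [[z, 2]] that is known before the other
    coefficients are chosen. *)

(** * Smooth bumps with compact support *)

(** Bounding the first-order remainder by a square is how derivatives are
    established both at the flat point of [flat] and for infinite series: such
    bounds can be summed over the terms of a series, whereas plain limits of
    difference quotients cannot. *)
Lemma is_derive_quadratic (R : realType) (f : R -> R) (x d C : R) :
  (forall y, `|f y - f x - (y - x) * d| <= C * (y - x) ^+ 2) ->
  is_derive x 1 f d.
Proof.
move=> H.
have C0 : 0 <= C.
  have := H (x + 1).
  have -> : x + 1 - x = 1 by ring.
  by rewrite expr1n mulr1; apply: le_trans.
suff cv : (fun h : R => h^-1 *: (f (h *: 1 + x) - f x)) @ 0^' --> d.
  apply: DeriveDef; first by apply/cvg_ex; exists d.
  by apply/cvg_lim.
apply/cvgrPdist_le => e e0.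
near=> h.
have h0 : h != 0 by near: h; exact: nbhs_dnbhs_neq.
have -> : d - h^-1 *: (f (h *: 1 + x) - f x)
    = - h^-1 * (f (h + x) - f x - (h + x - x) * d).
  rewrite scaler1 -[_ *: (_ : R)]/(_ * _); field; exact: h0.
rewrite normrM normrN normfV ler_pdivrMl ?normr_gt0//.
apply: le_trans (H _) _.
rewrite addrK -real_normK ?num_real// expr2 mulrCA ler_pM2l ?normr_gt0//.
have hs : `|h| <= e / (C + 1).
  near: h; apply: dnbhs0_le; by rewrite divr_gt0// ltr_wpDl.
apply: le_trans (_ : (C + 1) * `|h| <= _).
  by rewrite ler_wpM2r// lerDl.
by rewrite mulrC -ler_pdivlMr// ltr_wpDl.
Unshelve. all: by end_near. Qed.

(** For [y >= 0], [expR y = expR (y / n) ^+ n] and [expR (y / n) >= y / n], which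
    bounds each monomial. *)
Lemma poly_le_expR (R : realType) (p : {poly R}) :
  exists C : R, forall y, 0 <= y -> `|p.[y]| <= C * expR y.
Proof.
have mono n : exists C : R, forall y, 0 <= y -> y ^+ n <= C * expR y.
  case: n => [|n].
    by exists 1 => y y0; rewrite expr0 mul1r -expR0 ler_expR.
  exists (n.+1%:R ^+ n.+1) => y y0.
  rewrite -[X in expR X](@divfK _ n.+1%:R) ?pnatr_eq0// expRM_natr -exprMn.
  rewrite lerXn2r ?nnegrE ?mulr_ge0 ?ler0n ?expR_ge0//.
  rewrite mulrC -ler_pdivrMr ?ltr0n//.
  by apply: le_trans (expR_ge1Dx _); rewrite lerDr.
have [C HC] := choice mono.
exists (\sum_(i < size p) `|p`_i| * C i) => y y0.
rewrite horner_coef mulr_suml; apply: le_trans (ler_norm_sum _ _ _) _.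
apply: ler_sum => i _.
rewrite normrM [X in _ * X]ger0_norm ?exprn_ge0// -mulrA ler_wpM2l//.
exact: HC.
Qed.

(** The factor [p.[x^-1]] makes the family stable under differentiation; the
    classical flat function [exp (-1/x)] is the case [p = 1]. *)
Definition flat (R : realType) (p : {poly R}) (x : R) : R :=
  if 0 < x then p.[x^-1] * expR (- x^-1) else 0.

Lemma is_derive_horner (R : realType) (p : {poly R}) (x : R) :
  is_derive x 1 (horner p) (p^`()%R).[x].
Proof.
apply: DeriveDef; first exact: derivable_horner.
by rewrite -derive1E derivE.
Qed.

(** At [0] the growth bound on [y^2 * p.[y]], with [y = x^-1], shows that [flat p]
    is [O(x^2)], so that its derivative vanishes there. *)
Lemma is_derive_flat (R : realType) (p : {poly R}) (x : R) :
  is_derive x 1 (flat p) (flat ('X^2 * (p - p^`())) x).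
Proof.
have [x0|x0|x0] := ltgtP x 0.
- rewrite [X in is_derive _ _ _ X]/flat ltNge (ltW x0)/=.
  apply: (@near_eq_is_derive _ _ _ (cst 0)).
  near=> y; rewrite /flat ltNge ifN //= negbK; near: y.
  exact: lt_le_nbhsl.
- rewrite [X in is_derive _ _ _ X]/flat x0.
  have near_f : \near x, p.[x^-1] * expR (- x^-1) = flat p x.
    near=> y; rewrite /flat ifT //; near: y.
    exact: lt_nbhsr.
  apply: near_eq_is_derive near_f _.
  have xn0 : x != 0 by rewrite gt_eqF.
  have dinv : is_derive x 1 (fun y : R => y^-1) (- x ^- 2).
    apply: trigger_derive (is_deriveV (f := id) xn0 _) _.
    by rewrite -[_ *: (_ : R)]/(_ * _) mulr1.
  have d1 : is_derive x 1 (fun y => p.[y^-1]) ((p^`()).[x^-1] * (- x ^- 2)).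
    exact: (@is_derive1_comp _ (horner p) (fun y => y^-1) x _ _ (is_derive_horner _ _)).
  have d2 : is_derive x 1 (fun y => expR (- y^-1)) (expR (- x^-1) * (- - x ^- 2)).
    exact: (@is_derive1_comp _ expR (fun y => - y^-1) x _ _ (is_derive_expR _)).
  apply: trigger_derive (is_deriveM d1 d2) _.
  rewrite !hornerE -![_ *: (_ : R)]/(_ * _) opprK; field; exact: xn0.
- subst x; rewrite [X in is_derive _ _ _ X]/flat ltxx.
  have [C HC] := poly_le_expR (p * 'X^2).
  have C0 : 0 <= C.
    by have := HC 0 (lexx _); rewrite expR0 mulr1; exact: le_trans.
  apply: (@is_derive_quadratic _ _ _ _ C) => y.
  rewrite /flat ltxx mulr0 !subr0; case: ifPn => y0; last first.
    by rewrite normr0 mulr_ge0// sqr_ge0.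
  have := HC (y^-1); rewrite invr_ge0 (ltW y0) => /(_ isT).
  rewrite hornerM hornerXn normrM exprVn normfV [X in _ / X]ger0_norm ?sqr_ge0//.
  rewrite ler_pdivrMr ?exprn_gt0// => H.
  rewrite normrM [X in _ * X]ger0_norm ?expR_ge0// expRN ler_pdivrMr ?expR_gt0//.
  by rewrite mulrAC.
Unshelve. all: by end_near. Qed.

Definition flat_bump (R : realType) (w x : R) : R := flat 1 (w - (x - 1) ^+ 2).

(** A class of functions that contains the bump, is closed under differentiation
    and consists of functions vanishing off a bounded set: it contains all the
    derivatives of the bump without an explicit formula for them. *)
Inductive bump_comb (R : realType) (w : R) : (R -> R) -> Prop :=
| bump_comb_base (p q : {poly R}) :
    bump_comb w (fun x => q.[x] * flat p (w - (x - 1) ^+ 2))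
| bump_comb_add (f g : R -> R) :
    bump_comb w f -> bump_comb w g -> bump_comb w (fun x => f x + g x).

Lemma bump_comb_derive (R : realType) (w : R) (f : R -> R) : bump_comb w f ->
  exists2 df, bump_comb w df & forall x : R, is_derive x 1 f (df x).
Proof.
elim=> [p q|f1 f2 _ [d1 c1 D1] _ [d2 c2 D2]]; last first.
  exists (fun x => d1 x + d2 x); first exact: bump_comb_add.
  by move=> x; apply: is_deriveD.
(* [flat p] differentiates to [flat p'], and the inner function
   [w - (x - 1)^2] to [2 - 2 x]. *)
pose p' := 'X^2 * (p - p^`()).
exists (fun x => q^`().[x] * flat p (w - (x - 1) ^+ 2) +
   (q * (2 - 2 *: 'X)).[x] * flat p' (w - (x - 1) ^+ 2)).
  by apply: bump_comb_add; exact: bump_comb_base.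
move=> x.
have d0 : is_derive x 1 (fun x => w - (x - 1) ^+ 2) (2 - 2 * x).
  rewrite (_ : (fun x => _) = horner (w%:P - ('X - 1) ^+ 2)); last first.
    by apply/funext => y; rewrite !(hornerE, horner_exp).
  apply: trigger_derive (is_derive_horner _ _) _.
  rewrite !poly.derivE/= !hornerE; ring.
have d1 : is_derive x 1 (fun x => flat p (w - (x - 1) ^+ 2))
    (flat p' (w - (x - 1) ^+ 2) * (2 - 2 * x)).
  exact: (@is_derive1_comp _ (flat p) (fun x => w - (x - 1) ^+ 2) x _ _ (is_derive_flat _ _)).
apply: trigger_derive (is_deriveM (is_derive_horner q x) d1) _.
rewrite !hornerE -![_ *: (_ : R)]/(_ * _); ring.
Qed.

Lemma bump_comb_bump (R : realType) (w : R) : bump_comb w (flat_bump w).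
Proof.
rewrite (_ : flat_bump w = fun x => (1%:P : {poly R}).[x] * flat 1 (w - (x - 1) ^+ 2)).
  exact: bump_comb_base.
by apply/funext => x; rewrite hornerC mul1r.
Qed.

Lemma bump_comb_eq0 (R : realType) (w : R) (f : R -> R) : bump_comb w f ->
  forall x, w <= (x - 1) ^+ 2 -> f x = 0.
Proof.
elim=> [p q x wx|f1 f2 _ H1 _ H2 x wx]; last by rewrite H1// H2// addr0.
by rewrite /flat subr_gt0 ltNge wx/= mulr0.
Qed.

Lemma is_derive_continuous (R : realType) (f df : R -> R) :
  (forall x : R, is_derive x 1 f (df x)) -> continuous f.
Proof.
move=> H x; apply: differentiable_continuous; apply/derivable1_diffP.
by have := H x => -[].
Qed.

(** Continuity gives a bound on the segment from [0] to [2], outside of which the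
    function is zero. *)
Lemma bump_comb_bounded (R : realType) (w : R) (f : R -> R) : w <= 1 ->
  bump_comb w f -> exists B : R, forall x, `|f x| <= B.
Proof.
move=> w1 cf; have [df _ D] := bump_comb_derive cf.
have cont : continuous (fun x => `|f x|).
  by move=> x; apply: cvg_norm; exact: is_derive_continuous D x.
have [c _ Hc] := @EVT_max R (fun x => `|f x|) 0 2 (ltW (ltr0Sn _ _))
   (continuous_subspaceT cont).
exists `|f c| => x.
have [x02|x02] := boolP (x \in `[0, 2]%R); first exact: Hc.
rewrite (bump_comb_eq0 cf) ?normr0//.
apply: le_trans w1 _; move: x02; rewrite in_itv/= negb_and -!ltNge => /orP[]; nra.
Qed.

Lemma derive1n_is_derive (R : realType) (F : nat -> R -> R) :
  (forall m (x : R), is_derive x 1 (F m) (F m.+1 x)) ->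
  forall m, derive1n m (F 0%N) = F m.
Proof.
move=> H; elim=> [//|m IH]; rewrite derive1nS IH; apply/funext => x.
by rewrite derive1E; have := H m x => -[].
Qed.

(** Exhibiting the whole sequence of candidate derivatives avoids computing
    [derive1n]. *)
Lemma is_derive_smooth (R : realType) (F : nat -> R -> R) :
  (forall m (x : R), is_derive x 1 (F m) (F m.+1 x)) -> smooth (F 0%N).
Proof. by move=> H m x; rewrite (derive1n_is_derive H); have := H m x => -[]. Qed.

Lemma bump_derivatives (R : realType) (w : R) : w <= 1 ->
  exists G : nat -> R -> R,
    [/\ G 0%N = flat_bump w, (forall m (x : R), is_derive x 1 (G m) (G m.+1 x)) &
        forall m, exists B : R, forall x, `|G m x| <= B].
Proof.
move=> w1.
have st (f : {f | bump_comb w f}) : exists df : {f | bump_comb w f},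
    forall x : R, is_derive x 1 (sval f) (sval df x).
  by case: f => f cf; have [df cdf D] := bump_comb_derive cf; exists (exist _ df cdf).
have [d Hd] := choice st.
pose f0 : {f | bump_comb w f} := exist _ _ (bump_comb_bump w).
exists (fun m => sval (iter m d f0)); split=> // m.
exact: (bump_comb_bounded w1 (svalP _)).
Qed.

(** * Term-by-term differentiation *)

Lemma MVT_between (R : realType) (f df : R -> R) (x y : R) :
  (forall z : R, is_derive z 1 f (df z)) ->
  exists2 z, `|z - x| <= `|y - x| & f y - f x = df z * (y - x).
Proof.
move=> D; have cf A : {within A, continuous f}.
  by apply: continuous_subspaceT; exact: is_derive_continuous D.
have [xy|yx] := leP x y.
  have [z] := MVT_segment xy (fun z _ => D z) (cf _).
  rewrite in_itv/= => /andP[xz zy] E; exists z => //.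
  by rewrite !ger0_norm ?subr_ge0// lerB.
have [z] := MVT_segment (ltW yx) (fun z _ => D z) (cf _).
rewrite in_itv/= => /andP[yz zx] E; exists z.
  by rewrite !(distrC _ x) !ger0_norm ?subr_ge0// ?lerB// ltW.
by rewrite -opprB E; ring.
Qed.

(** Two applications of the mean value theorem: the increment is
    [F1 z * (y - x)] for some [z], and [F1 z - F1 x] is at most [C * `|z - x|]. *)
Lemma taylor_quadratic (R : realType) (F0 F1 F2 : R -> R) (C x y : R) :
  (forall z : R, is_derive z 1 F0 (F1 z)) ->
  (forall z : R, is_derive z 1 F1 (F2 z)) ->
  (forall z, `|F2 z| <= C) ->
  `|F0 y - F0 x - (y - x) * F1 x| <= C * (y - x) ^+ 2.
Proof.
move=> D0 D1 HC.
have [z zx ->] := MVT_between x y D0.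
have [t _ E] := MVT_between x z D1.
have -> : F1 z * (y - x) - (y - x) * F1 x = (F1 z - F1 x) * (y - x) by ring.
rewrite E !normrM -mulrA -[X in _ <= _ * X]real_normK ?num_real// expr2.
by rewrite ler_pM ?mulr_ge0// ler_wpM2r.
Qed.

Lemma geometric_series_bound (R : realType) (a : nat -> R) (C : R) :
  (forall k, `|a k| <= C / 2 ^+ k) ->
  cvgn (series a) /\ `|limn (series a)| <= C * 2.
Proof.
move=> H.
have h1 : `|2^-1 : R| < 1 by rewrite ger0_norm ?invr_ge0// invf_lt1// ltr1n.
have E k : C / 2 ^+ k = geometric C 2^-1 k by rewrite /geometric/= exprVn.
have cg : cvgn (series (geometric C (2^-1))) := is_cvg_geometric_series h1.
have lg : limn (series (geometric C (2^-1))) = C * 2.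
  have /cvg_lim -> // := @cvg_geometric_series R C _ h1.
  by congr (_ * _); field.
have g0 k : 0 <= geometric C 2^-1 k by rewrite -E; exact: le_trans (H k).
have ag k : `|a k| <= geometric C 2^-1 k by rewrite -E.
have cn : cvgn [normed series a].
  exact: (series_le_cvg (fun k => normr_ge0 _) g0 ag cg).
split; first exact: normed_cvg.
apply: le_trans (lim_series_norm cn) _; rewrite -lg.
exact: lim_series_le.
Qed.

Lemma term_le_series (R : realType) (a : nat -> R) (j : nat) :
  (forall k, 0 <= a k) -> cvgn (series a) -> a j <= limn (series a).
Proof.
move=> a0 ca; apply: limr_ge => //.
exists j.+1 => // n /= jn; rewrite /series/= big_mkord.
by rewrite (bigD1 (Ordinal jn))//= lerDl sumr_ge0.
Qed.

(** The remainder of the series is the series of the remainders, and each of these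
    is controlled by a bound on the second derivative of the term; this is why
    the bounds on [F k m.+2] give the derivative of the [m]-th series. *)
Lemma series_is_derive (R : realType) (F : nat -> nat -> R -> R) :
  (forall k m (x : R), is_derive x 1 (F k m) (F k m.+1 x)) ->
  (forall m, exists C, forall k x, `|F k m x| <= C / 2 ^+ k) ->
  forall m (x : R), is_derive x 1 (fun y => limn (series (fun k => F k m y)))
     (limn (series (fun k => F k m.+1 x))).
Proof.
move=> D B m x.
have cv n y : cvgn (series (fun k => F k n y)).
  by have [C HC] := B n; apply: (geometric_series_bound (HC^~ y)).1.
have [C HC] := B m.+2.
apply: (@is_derive_quadratic _ _ _ _ (C * 2)) => y.
have c1 := is_cvg_seriesB (cv m y) (cv m x).
have c2 := @is_cvg_seriesZ R _ (y - x) (cv m.+1 x).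
rewrite -[(y - x) * _](lim_seriesZ (y - x) (cv m.+1 x)).
rewrite -lim_seriesB// -lim_seriesB// mulrAC.
apply: (geometric_series_bound _).2 => k; rewrite mulrAC.
exact: taylor_quadratic.
Qed.

(** Diagonal choice: [kappa k] compensates [B k m] for the finitely many [m <= k],
    and the finitely many indices [k < m] that are left out for a given [m] are
    absorbed by the constant [C]. *)
Lemma diagonal_weights (R : realType) (B : nat -> nat -> R) :
  (forall k m, 0 <= B k m) ->
  exists kappa : nat -> R,
    (forall k, 0 < kappa k <= 2^-1 / 2 ^+ k) /\
    (forall m, exists C, forall k, kappa k * B k m <= C / 2 ^+ k).
Proof.
move=> B0.
(* [1 +] keeps the denominators away from [0]. *)
pose S k := 1 + \sum_(m < k.+1) B k m.
have S1 k : 1 <= S k by rewrite lerDl sumr_ge0.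
have S0 k : 0 < S k by apply: lt_le_trans (S1 k).
have p0 k : 0 < (2 : R) ^+ k by rewrite exprn_gt0.
exists (fun k => 2^-1 / 2 ^+ k / S k); split.
  move=> k; have q0 : 0 < 2^-1 / 2 ^+ k :> R by rewrite divr_gt0 ?invr_gt0.
  by rewrite divr_gt0//= ler_pdivrMr// ler_peMr// ltW.
move=> m.
exists (1 + \sum_(j < m) B j m) => k.
have -> : 2^-1 / 2 ^+ k / S k * B k m = 2^-1 * (B k m / S k) / 2 ^+ k by ring.
rewrite ler_pM2r ?invr_gt0//.
apply: (@le_trans _ _ (B k m / S k)).
  by rewrite ler_piMl ?divr_ge0 ?(ltW (S0 _))// invf_le1 ?ler1n.
have [km|mk] := ltnP k m.
  apply: (@le_trans _ _ (B k m)); first by rewrite ler_pdivrMr// ler_peMr.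
  by rewrite (bigD1 (Ordinal km))//= addrCA lerDl addr_ge0// sumr_ge0.
apply: (@le_trans _ _ 1); last by rewrite lerDl sumr_ge0.
rewrite ler_pdivrMr// mul1r /S (bigD1 (Ordinal (_ : m < k.+1)%N))//=.
by rewrite addrCA lerDl addr_ge0// sumr_ge0.
Qed.

Definition mix (R : realType) (w u : nat -> R) (x : R) : R :=
  limn (series (fun k => u k * flat_bump (w k) x)).

(** The threshold [kappa] is uniform in [u]: the coefficients can still be chosen
    afterwards, in any way below it. *)
Lemma smooth_mix (R : realType) (w : nat -> R) : (forall k, w k <= 1) ->
  exists kappa : nat -> R,
    (forall k, 0 < kappa k <= 2^-1 / 2 ^+ k) /\
    (forall u, (forall k, 0 <= u k <= kappa k) -> smooth (mix w u)).
Proof.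
move=> w1.
have [G HG] := choice (fun k => bump_derivatives (w1 k)).
have [B HB] : exists B : nat -> nat -> R, forall k m x, `|G k m x| <= B k m.
  have h k : exists Bk : nat -> R, forall m x, `|G k m x| <= Bk m.
    by have [_ _ /choice[Bk h]] := HG k; exists Bk.
  by have [B HB] := choice h; exists B.
have B0 k m : 0 <= B k m by exact: le_trans (HB k m 0).
have [kappa [k0 kB]] := diagonal_weights B0.
exists kappa; split=> // u Hu.
pose F k m x := u k * G k m x.
have -> : mix w u = (fun m x => limn (series (fun k => F k m x))) 0%N.
  apply/funext => x; congr (limn (series _)); apply/funext => k.
  by have [E _ _] := HG k; rewrite /F E.
apply: (@is_derive_smooth _ (fun m x => limn (series (fun k => F k m x)))).
apply: series_is_derive.
  move=> k m x; have [_ D _] := HG k.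
  by apply: trigger_derive (is_deriveZ (u k) (D m x)) _.
move=> m; have [C HC] := kB m; exists C => k x.
rewrite /F normrM; have /andP[u0 uk] := Hu k; rewrite ger0_norm//.
by apply: le_trans (HC k); rewrite ler_pM.
Qed.

Lemma smoothZ (R : realType) (c : R) (f : R -> R) :
  smooth f -> smooth (fun x => c * f x).
Proof.
move=> sf; apply: (@is_derive_smooth _ (fun m x => c * derive1n m f x)) => m x.
have D : is_derive x 1 (derive1n m f) (derive1n m.+1 f x).
  by apply: DeriveDef (sf m x) _; rewrite derive1nS derive1E.
exact: trigger_derive (is_deriveZ c D) _.
Qed.

Lemma smooth_continuous (R : realType) (f : R -> R) : smooth f -> continuous f.
Proof.
move=> sf x; apply: differentiable_continuous; apply/derivable1_diffP.
exact: (sf 0%N).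
Qed.

(** * Mixtures of concentric bumps and unimodality *)

Lemma flat_bump_ge0 (R : realType) (w x : R) : 0 <= flat_bump w x.
Proof.
by rewrite /flat_bump /flat; case: ifPn => // _; rewrite hornerC mul1r expR_ge0.
Qed.

Lemma flat_bump_gt0 (R : realType) (w x : R) :
  (x - 1) ^+ 2 < w -> 0 < flat_bump w x.
Proof.
by move=> H; rewrite /flat_bump /flat subr_gt0 H hornerC mul1r expR_gt0.
Qed.

Lemma flat_bump_eq0 (R : realType) (w x : R) :
  w <= (x - 1) ^+ 2 -> flat_bump w x = 0.
Proof. by move=> H; rewrite /flat_bump /flat subr_gt0 ltNge H. Qed.

Lemma flat_bump_le1 (R : realType) (w x : R) : flat_bump w x <= 1.
Proof.
rewrite /flat_bump /flat; case: ifPn => // h.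
by rewrite hornerC mul1r -[leRHS]expR0 ler_expR oppr_le0 invr_ge0 ltW.
Qed.

Lemma flat_bump_lt (R : realType) (w x y : R) :
  (y - 1) ^+ 2 < (x - 1) ^+ 2 -> (y - 1) ^+ 2 < w -> flat_bump w x < flat_bump w y.
Proof.
move=> yx yw; have [wx|xw] := leP w ((x - 1) ^+ 2).
  by rewrite flat_bump_eq0// flat_bump_gt0.
rewrite /flat_bump /flat !subr_gt0 xw yw !hornerC !mul1r ltr_expR ltrN2.
by rewrite ltf_pV2 ?posrE ?subr_gt0// ltrD2l ltrN2.
Qed.

Lemma flat_bump_le (R : realType) (w x y : R) :
  (y - 1) ^+ 2 <= (x - 1) ^+ 2 -> flat_bump w x <= flat_bump w y.
Proof.
rewrite le_eqVlt => /orP[/eqP E|yx]; first by rewrite /flat_bump E.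
have [wy|yw] := leP w ((y - 1) ^+ 2); last exact/ltW/flat_bump_lt.
by rewrite flat_bump_eq0 ?flat_bump_ge0// (le_trans wy)// ltW.
Qed.

Section mix_shape.
Variables (R : realType) (w u : nat -> R).
Hypothesis u_bound : forall k, 0 <= u k <= 2^-1 / 2 ^+ k.

Lemma mix_term_ge0 k x : 0 <= u k * flat_bump (w k) x.
Proof. by have /andP[u0 _] := u_bound k; rewrite mulr_ge0 ?flat_bump_ge0. Qed.

(** Convergence comes with the bound because both follow from comparison with the
    same geometric series; the case of a small [eps] controls the density far
    from the centre. *)
Lemma mix_term_le eps x :
  (forall k, u k * flat_bump (w k) x <= eps * (2^-1 / 2 ^+ k)) ->
  cvgn (series (fun k => u k * flat_bump (w k) x)) /\ mix w u x <= eps.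
Proof.
move=> H.
have h k : `|u k * flat_bump (w k) x| <= (eps / 2) / 2 ^+ k.
  by rewrite ger0_norm ?mix_term_ge0// -mulrA.
have [cv le] := geometric_series_bound h; split=> //.
apply: le_trans (ler_norm _) _; apply: le_trans le _.
by rewrite divfK.
Qed.

Let mix_bound x k : u k * flat_bump (w k) x <= 1 * (2^-1 / 2 ^+ k).
Proof.
have /andP[u0 u1] := u_bound k; rewrite mul1r; apply: le_trans u1.
by rewrite ler_piMr ?flat_bump_le1.
Qed.

Lemma mix_cvg x : cvgn (series (fun k => u k * flat_bump (w k) x)).
Proof. exact: (mix_term_le (mix_bound x)).1. Qed.

Lemma mix_le1 x : mix w u x <= 1.
Proof. exact: (mix_term_le (mix_bound x)).2. Qed.

Lemma mix_ge_term k x : u k * flat_bump (w k) x <= mix w u x.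
Proof.
apply: (@term_le_series _ (fun k => u k * flat_bump (w k) x)) => [j|].
  exact: mix_term_ge0.
exact: mix_cvg.
Qed.

Lemma mix_ge0 x : 0 <= mix w u x.
Proof. exact: le_trans (mix_term_ge0 0 x) (mix_ge_term 0 x). Qed.

Lemma mix_eq0 x : (forall k, w k <= (x - 1) ^+ 2) -> mix w u x = 0.
Proof.
move=> H; apply/eqP; rewrite eq_le mix_ge0 andbT.
have h k : u k * flat_bump (w k) x <= 0 * (2^-1 / 2 ^+ k).
  by rewrite flat_bump_eq0// mulr0 mul0r.
exact: (mix_term_le h).2.
Qed.

(** All terms compare weakly, so one strict comparison, that of the term [k], is
    enough. *)
Lemma mix_lt x y k : (y - 1) ^+ 2 < (x - 1) ^+ 2 -> (y - 1) ^+ 2 < w k -> 0 < u k ->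
  mix w u x < mix w u y.
Proof.
move=> yx yw u0; have c := is_cvg_seriesB (@mix_cvg y) (@mix_cvg x).
rewrite -subr_gt0 /mix -lim_seriesB; [|exact: mix_cvg..].
apply: lt_le_trans (@term_le_series _ _ k _ c).
  by rewrite -[(_ - _) k]/(u k * _ - u k * _) -mulrBr mulr_gt0// subr_gt0 flat_bump_lt.
move=> j; rewrite -[(_ - _) j]/(u j * _ - u j * _) -mulrBr.
have /andP[uj _] := u_bound j.
by rewrite mulr_ge0// subr_ge0 flat_bump_le// ltW.
Qed.

End mix_shape.

(** A point other than [1] where [f] is positive is not a local maximum, since [f]
    strictly increases on the way to [1]. *)
Lemma unimodal_of_decreasing (R : realType) (f : R -> R) :
  continuous f ->
  (forall x, 1 <= (x - 1) ^+ 2 -> f x = 0) ->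
  (forall x, (x - 1) ^+ 2 < 1 -> 0 < f x) ->
  (forall x y, (y - 1) ^+ 2 < (x - 1) ^+ 2 -> (x - 1) ^+ 2 < 1 -> f x < f y) ->
  unimodal f.
Proof.
move=> cf f0 fp fd; split=> //.
  apply: (subclosed_compact (@closed_closure _ _) (@segment_compact R 0 2)).
  rewrite [X in _ `<=` X](closure_id _).1; last exact: interval_closed.
  apply: closure_subset => x /= fx; rewrite in_itv/=.
  rewrite leNgt [x <= 2]leNgt -negb_or; apply/negP => h.
  move/eqP: fx; apply; apply: f0; case/orP: h => h; nra.
have f1 : 0 < f 1 by apply: fp; rewrite subrr expr0n ltr01.
exists 1; split.
  split=> //; rewrite /local_max; near=> y.
  have [y1|y1] := ltP ((y - 1) ^+ 2) 1; last by rewrite f0// ltW.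
  have [->//|yn] := eqVneq y 1.
  by apply/ltW/fd => //; rewrite subrr expr0n exprn_even_gt0//= subr_eq0.
move=> x [fx [e /= e0 ex]].
have x1 : (x - 1) ^+ 2 < 1.
  by rewrite ltNge; apply/negP => /f0 E; rewrite E ltxx in fx.
apply/eqP; apply/negPn/negP => xn.
(* A fraction [t] of the way from [x] to [1]; as [`|1 - x| < 1], the move is
   shorter than [e]. *)
pose t := Num.min (2^-1) (e / 2).
have t0 : 0 < t by rewrite lt_min invr_gt0 ltr0n divr_gt0.
have t1 : t <= 2^-1 by rewrite ge_min lexx.
have te : t <= e / 2 by rewrite ge_min lexx orbT.
have xp : 0 < (x - 1) ^+ 2 by rewrite exprn_even_gt0//= subr_eq0 eq_sym.
have bx : ball x e (x + t * (1 - x)).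
  rewrite /ball/= opprD addNKr normrN normrM (ger0_norm (ltW t0)).
  have : `|1 - x| < 1.
    by rewrite distrC ltr_norml; apply/andP; split; nra.
  have := normr_ge0 (1 - x); nra.
have := ex _ bx; rewrite leNgt => /negP; apply; apply: fd => //.
have -> : (x + t * (1 - x) - 1) ^+ 2 = (1 - t) ^+ 2 * (x - 1) ^+ 2 by ring.
rewrite gtr_pMl//; nra.
Unshelve. all: by end_near. Qed.

(** * Probability measures with a density supported in the segment from 0 to 2 *)

Section density_probability.
Variables (R : realType) (f : R -> R).
Hypothesis mf : measurable_fun [set: R] f.
Hypothesis f_ge0 : forall x, 0 <= f x.
Hypothesis int_f : (\int[lebesgue_measure]_x (f x)%:E = 1)%E.

(** The hypotheses are arguments of the definition so that the measure structure
    can be attached to it canonically. *)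
Definition density_prob of measurable_fun [set: R] f & (forall x, 0 <= f x) &
    (\int[lebesgue_measure]_x (f x)%:E = 1)%E : set (measurableTypeR R) -> \bar R :=
  fun A => (\int[lebesgue_measure]_(x in A) (f x)%:E)%E.

Local Notation P := (density_prob mf f_ge0 int_f).

Let P0 : P set0 = 0%E.
Proof. by rewrite /density_prob integral_set0. Qed.

Let P_ge0 A : (0 <= P A)%E.
Proof. by apply: integral_ge0 => x _; rewrite lee_fin. Qed.

Let P_sigma_additive : semi_sigma_additive P.
Proof.
move=> /= A mA tA mUA.
rewrite /density_prob/= ge0_integral_bigcup//=.
- apply: is_cvg_ereal_nneg_natsum_cond => n _ _.
  by apply: integral_ge0 => x _; rewrite lee_fin.
- by apply/measurable_EFinP; apply: measurable_funTS.
- by move=> x _; rewrite lee_fin.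
Qed.

HB.instance Definition _ := isMeasure.Build _ _ _ P P0 P_ge0 P_sigma_additive.

Let PT : P [set: _] = 1%E.
Proof. exact: int_f. Qed.

HB.instance Definition _ := @Measure_isProbability.Build _ _ R P PT.

Lemma exists_density_probability :
  exists mu : probability (measurableTypeR R) R, is_density mu f.
Proof. by exists P; split. Qed.

End density_probability.

Section moments.
Variables (R : realType) (mu : probability (measurableTypeR R) R).
Variables (f : R -> R).
Hypothesis mu_f : is_density mu f.
Hypothesis f_out : forall x, 1 <= (x - 1) ^+ 2 -> f x = 0.

Lemma density_null (A : set R) : measurable A ->
  (forall x, A x -> f x = 0) -> mu A = 0%E.
Proof.
move=> mA H; have [_ _ ->//] := mu_f.
by apply: integral0_eq => x /H ->.
Qed.

Lemma density_gt2_null : mu `]2, +oo[%classic = 0%E.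
Proof.
apply: density_null => // x /=; rewrite in_itv/= andbT => x2.
by apply: f_out; nra.
Qed.

Lemma density_lt0_null : mu `]-oo, 0[%classic = 0%E.
Proof.
apply: density_null => // x /=; rewrite in_itv/= => x2.
by apply: f_out; nra.
Qed.

Lemma measurable_pow_EFin n (A : set (measurableTypeR R)) : 
  measurable_fun A (fun t : measurableTypeR R => (t ^+ n)%:E).
Proof.
apply/measurable_EFinP; apply: measurable_funTS; exact: exprn_measurable.
Qed.

(** Markov's inequality for [t ^+ n]. *)
Lemma moment_ge n (a : R) : 0 <= a ->
  ((a ^+ n)%:E * mu `[a, +oo[%classic <= moment mu n)%E.
Proof.
move=> a0; rewrite -integral_cst//.
apply: (@le_trans _ _ (\int[mu]_(t in `[a, +oo[) (t ^+ n)%:E))%E.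
  apply: ge0_le_integral => //.
  - by move=> x _; rewrite lee_fin exprn_ge0.
  - exact: measurable_pow_EFin.
  - move=> x /=; rewrite in_itv/= andbT => ax.
    by rewrite lee_fin lerXn2r// nnegrE// (le_trans a0).
apply: ge0_subset_integral => //.
- exact: measurable_pow_EFin.
- by move=> x /=; rewrite in_itv/= andbT => x0; rewrite lee_fin exprn_ge0.
- by move=> x /=; rewrite !in_itv/= !andbT; exact: le_trans.
Qed.

Lemma integral_pow_le n (A : set (measurableTypeR R)) (c : R) : measurable A ->
  (forall x, A x -> 0 <= x <= c) ->
  (\int[mu]_(t in A) (t ^+ n)%:E <= (c ^+ n)%:E * mu A)%E.
Proof.
move=> mA Ac; rewrite -integral_cst//; apply: ge0_le_integral => //.
- by move=> x /Ac/andP[x0 _]; rewrite lee_fin exprn_ge0.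
- exact: measurable_pow_EFin.
- move=> x /Ac/andP[x0 xc].
  by rewrite lee_fin lerXn2r// nnegrE// (le_trans x0).
Qed.

(** Split the half-line at [b] and at [2]: the mass up to [b] is at most [1], and
    there is none beyond [2]. *)
Lemma moment_le n (b : R) : 0 <= b -> b <= 2 ->
  (moment mu n <= (b ^+ n)%:E + (2 ^+ n)%:E * mu `]b, 2%R]%classic)%E.
Proof.
move=> b0 b2.
have E : `[0%R, +oo[%classic = (`[0%R, b] `|` `]b, 2%R]) `|` `]2%R, +oo[ :> set R.
  apply/seteqP; split => x /=; rewrite !in_itv/= !andbT.
    move=> x0; have [xb|bx] := leP x b; first by left; left; rewrite x0.
    by have [x2|x2] := leP x 2; [left; right|right].
  by move=> [[/andP[]//|/andP[bx _]]|x2]; lra.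
have ge0 (A : set R) : A `<=` `[0%R, +oo[%classic -> forall x, A x -> (0 <= (x ^+ n)%:E)%E.
  by move=> H x /H /=; rewrite in_itv/= andbT => x0; rewrite lee_fin exprn_ge0.
rewrite /moment E ge0_integral_setU//=; last 4 first.
- exact: measurableU.
- exact: measurable_pow_EFin.
- by apply: ge0; rewrite E.
- apply/disj_setPS => x /=; rewrite !in_itv/= andbT.
  by move=> [[/andP[x0 xb]|/andP[bx xb]]]; lra.
rewrite [X in (_ + X)%E](_ : _ = 0%E) ?adde0; last first.
  by apply: null_set_integral => //; [exact: measurable_pow_EFin|exact: density_gt2_null].
(* Now split the segment from [0] to [2] at [b]. *)
rewrite ge0_integral_setU//=; last 3 first.
- exact: measurable_pow_EFin.
- by apply: ge0; rewrite E; exact: subsetUl.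
- apply/disj_setPS => x /=; rewrite !in_itv/=.
  by move=> [/andP[x0 xb] /andP[bx _]]; lra.
apply: leeD; last first.
  apply: integral_pow_le => // x /=; rewrite in_itv/= => /andP[bx ->].
  by rewrite andbT (le_trans b0)// ltW.
apply: (@le_trans _ _ ((b ^+ n)%:E * mu `[0%R, b]%classic)%E).
  by apply: integral_pow_le => // x /=; rewrite in_itv.
rewrite -[leRHS]mule1 lee_wpmul2l// ?lee_fin ?exprn_ge0// probability_le1//.
Qed.

(** Finiteness of the moments is [moment_le] at [b = 2]. *)
Lemma density_tail_domain : tail_domain mu.
Proof.
split; first exact: density_lt0_null.
move=> n; apply/integrableP; split; first exact: measurable_pow_EFin.
have -> : (\int[mu]_(x in `[0%R, +oo[%classic) `|(x ^+ n)%:E| = moment mu n)%E.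
  apply: eq_integral => x; rewrite inE/= in_itv/= andbT => x0.
  by rewrite ger0_norm ?exprn_ge0.
apply: le_lt_trans (moment_le n (ler0n _ 2) (lexx _)) _.
by rewrite set_itvoc0 measure0 mule0 adde0 ltry.
Qed.

Lemma support_sub_segment : measure_support mu `<=` `[0%R, 2%R].
Proof.
move=> x H /=; apply/negPn/negP => h.
have O : open (~` `[0%R, 2%R] : set R) by apply: closed_openC; exact: interval_closed.
have := H _ O (negP h).
suff E : mu (~` `[0%R, 2%R]) = 0%E by rewrite [X in (_ < X)%E]E ltxx.
apply: density_null; first exact: measurableC.
move=> y /=; rewrite in_itv/= => /negP; rewrite negb_and -!ltNge => {h}h.
by apply: f_out; case/orP: h => h; nra.
Qed.

(** A support is always closed, and this one lies in a compact segment. *)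
Lemma compact_measure_support : compact (measure_support mu).
Proof.
apply: (subclosed_compact _ (@segment_compact R 0 2) support_sub_segment).
rewrite -openC openE => x /=.
rewrite /measure_support => /existsNP[U /not_implyP[oU /not_implyP[Ux U0]]].
apply: filterS (open_nbhs_nbhs (conj oU Ux)) => y Uy /= H.
exact/U0/H.
Qed.

Lemma density_smooth_unimodal : smooth f -> unimodal f -> smooth_unimodal_measure mu.
Proof.
move=> sf uf; split; [exact: density_tail_domain|exact: compact_measure_support| |by exists f].
move=> x /support_sub_segment /=; rewrite !in_itv/= andbT; by case/andP.
Qed.
End moments.

Lemma integral_ge_itv (R : realType) (f : R -> R) (A : set R) (c p q : R) :
  measurable_fun [set: R] f -> (forall x, 0 <= f x) -> measurable A ->
  `[p, q] `<=` A -> 0 <= c -> p <= q ->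
  (forall x, p <= x <= q -> c <= f x) ->
  ((c * (q - p))%:E <= \int[lebesgue_measure]_(x in A) (f x)%:E)%E.
Proof.
move=> mf f0 mA pqA c0 pq cf.
have mfE B : measurable_fun B (fun x => (f x)%:E).
  by apply/measurable_EFinP; apply: measurable_funTS.
apply: (@le_trans _ _ (\int[lebesgue_measure]_(x in `[p, q]) (f x)%:E)%E); last first.
  by apply: ge0_subset_integral => //; [exact: mfE|move=> x _; rewrite lee_fin].
apply: (@le_trans _ _ (\int[lebesgue_measure]_(x in `[p, q]) c%:E)%E).
  rewrite integral_cst//= lebesgue_measure_itv/= lte_fin.
  move: pq; rewrite le_eqVlt => /orP[/eqP->|pq]; last first.
    by rewrite pq -EFinB -EFinM.
  rewrite ltxx.
  by rewrite mule0 subrr mulr0.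
by apply: ge0_le_integral => //=; exact: mfE.
Qed.

Lemma integral_le_itv (R : realType) (f : R -> R) (c p q : R) :
  measurable_fun [set: R] f -> (forall x, 0 <= f x) ->
  p <= q -> (forall x, p < x <= q -> f x <= c) ->
  (\int[lebesgue_measure]_(x in `]p, q]) (f x)%:E <= (c * (q - p))%:E)%E.
Proof.
move=> mf f0 pq cf.
have mfE B : measurable_fun B (fun x => (f x)%:E).
  by apply/measurable_EFinP; apply: measurable_funTS.
apply: (@le_trans _ _ (\int[lebesgue_measure]_(x in `]p, q]) c%:E)%E).
  apply: ge0_le_integral => //=.
  - by move=> x _; rewrite lee_fin.
  - exact: mfE.
rewrite integral_cst//= lebesgue_measure_itv/= lte_fin.
move: pq; rewrite le_eqVlt => /orP[/eqP->|pq]; last first.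
  by rewrite pq -EFinB -EFinM.
rewrite ltxx.
by rewrite mule0 subrr mulr0.
Qed.

(** The bounds on [Z] do not depend on [F] beyond [z]; they allow normalized
    densities to be compared without knowing the constants. *)
Lemma normalizing_constant (R : realType) (F : R -> R) (z : R) :
  measurable_fun [set: R] F -> (forall x, 0 <= F x <= 1) ->
  (forall x, 1 <= (x - 1) ^+ 2 -> F x = 0) -> 0 < z ->
  (z%:E <= \int[lebesgue_measure]_x (F x)%:E)%E ->
  exists2 Z, z <= Z <= 2 & (\int[lebesgue_measure]_x (Z^-1 * F x)%:E = 1)%E.
Proof.
move=> mF F01 F0 z0 zF.
have Fge0 x : 0 <= F x by case/andP: (F01 x).
have mFE B : measurable_fun B (fun x => (F x)%:E).
  by apply/measurable_EFinP; apply: measurable_funTS.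
have le2 : (\int[lebesgue_measure]_x (F x)%:E <= 2%:E)%E.
  have -> : (\int[lebesgue_measure]_x (F x)%:E = \int[lebesgue_measure]_(x in `]0%R, 2%R]) (F x)%:E)%E.
    rewrite [RHS]integral_mkcond; apply: eq_integral => x _.
    rewrite patchE; case: ifPn => //.
    rewrite notin_setE/= in_itv/= => /negP; rewrite negb_and -leNgt -ltNge => h.
    by rewrite F0//; case/orP: h => h; nra.
  have := @integral_le_itv R F 1 0 2 mF Fge0 (ler0n _ _).
  by rewrite subr0 mul1r; apply => x _; case/andP: (F01 x).
have fin : (\int[lebesgue_measure]_x (F x)%:E)%E \is a fin_num.
  rewrite ge0_fin_numE; first exact: le_lt_trans le2 (ltry _).
  by apply: integral_ge0 => x _; rewrite lee_fin.
exists (fine (\int[lebesgue_measure]_x (F x)%:E)).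
  by rewrite -!lee_fin fineK// zF.
have Z0 : 0 < fine (\int[lebesgue_measure]_x (F x)%:E).
  by apply: lt_le_trans z0 _; rewrite -lee_fin fineK.
under eq_integral do rewrite EFinM.
rewrite ge0_integralZl//=; last 3 first.
- exact: mFE.
- by move=> x _; rewrite lee_fin.
- by rewrite lee_fin invr_ge0 ltW.
by rewrite -[X in (_ * X)%E]fineK// -EFinM mulVf// gt_eqF.
Qed.

(** The moment of [nu] is split at [b] as in [moment_le], that of [mu] is bounded
    below by its mass beyond [a]; [n] large favours [a > b], and a small [eps]
    absorbs the factor [2 ^+ n]. *)
Lemma moment_lt (R : realType) (mu nu : probability (measurableTypeR R) R)
    (f g : R -> R) (a a' b c eps : R) (n : nat) :
  is_density mu f -> is_density nu g ->
  (forall x, 1 <= (x - 1) ^+ 2 -> g x = 0) ->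
  0 <= a -> a <= a' -> 0 <= c -> (forall x, a <= x <= a' -> c <= f x) ->
  0 <= b <= 2 -> (forall x, b < x -> g x <= eps) ->
  b ^+ n + 2 ^+ n * (eps * (2 - b)) < a ^+ n * (c * (a' - a)) ->
  (moment nu n < moment mu n)%E.
Proof.
move=> mu_f nu_g g0 a0 aa' c0 cf /andP[b0 b2] g_eps lt.
apply: le_lt_trans (moment_le nu_g g0 n b0 b2) _.
apply: lt_le_trans (moment_ge mu n a0).
have [mf f_ge0 ->//] := mu_f; have [mg g_ge0 ->//] := nu_g.
apply: (@le_lt_trans _ _ (b ^+ n + 2 ^+ n * (eps * (2 - b)))%:E).
  rewrite EFinD EFinM leeD2l// lee_wpmul2l ?lee_fin ?exprn_ge0//.
  by apply: integral_le_itv => // x /andP[bx _]; exact: g_eps.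
apply: (@lt_le_trans _ _ (a ^+ n * (c * (a' - a)))%:E); first by rewrite lte_fin.
rewrite EFinM lee_wpmul2l ?lee_fin ?exprn_ge0//.
apply: integral_ge_itv => //.
by move=> x /=; rewrite !in_itv/= andbT => /andP[].
Qed.

(** * Choice of the radii and of the weights *)

(** Stage [k] takes [n k] so large that [a k ^+ n k] beats [b k ^+ n k] by the
    factor [e k * s k / 4], and then caps all later weights by a quantity that
    depends on [n k].  Taking the minimum with the previous weight keeps all
    the earlier caps in force. *)
Lemma greedy_weights (R : realType) (a b s : nat -> R) (z : R) :
  (forall k, 0 <= b k < a k) -> (forall k, 0 < s k) -> 0 < z ->
  exists (e : nat -> R) (n : nat -> nat), 
   [/\ forall k, 0 < e k <= 1,
       forall k, (k <= n k)%N,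
       forall k, b k ^+ n k < a k ^+ n k * (e k * s k) / 4 &
       forall k j, (k < j)%N ->
         e j <= a k ^+ n k * (e k * s k) * z / 8 / 2 ^+ n k].
Proof.
move=> ab s0 z0.
have a0 k : 0 < a k by case/andP: (ab k) => b0; exact: le_lt_trans.
have exN k d : exists n : nat, 0 < d -> (k <= n)%N /\ b k ^+ n < a k ^+ n * (d * s k) / 4.
  have [d0|d0] := ltP 0 d; last by exists 0%N.
  have /andP[b0 ba] := ab k.
  have h : `|b k / a k| < 1.
    by rewrite ger0_norm ?divr_ge0 ?(ltW (a0 k))// ltr_pdivrMr// mul1r.
  have e0 : 0 < d * s k / 4 by rewrite divr_gt0 ?mulr_gt0.
  have [N _ HN] := (cvgr0Pnorm_lt _).1 (cvg_expr h) _ e0.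
  exists (maxn k N) => _; split; first exact: leq_maxl.
  have := HN (maxn k N) (leq_maxr _ _).
  rewrite ger0_norm ?exprn_ge0 ?divr_ge0 ?(ltW (a0 k))// expr_div_n ltr_pdivrMr ?exprn_gt0//.
  by rewrite mulrC mulrA.
have [N HN] : exists N : nat -> R -> nat, forall k d, 0 < d ->
    (k <= N k d)%N /\ b k ^+ N k d < a k ^+ N k d * (d * s k) / 4.
  have [N HN] := choice (fun kd : nat * R => exN kd.1 kd.2).
  by exists (fun k d => N (k, d)) => k d; exact: (HN (k, d)).
pose Psi k d := a k ^+ N k d * (d * s k) * z / 8 / 2 ^+ N k d.
have Psi0 k d : 0 < d -> 0 < Psi k d.
  by move=> d0; rewrite !divr_gt0 ?mulr_gt0 ?exprn_gt0.
(* The cap imposed at stage [k'] applies to all indices larger than [k']. *)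
pose e := fix e k := if k is k'.+1 then Num.min (e k') (Psi k' (e k')) else 1 : R.
have e0 k : 0 < e k by elim: k => [|k IH] /=; rewrite ?ltr01// lt_min IH Psi0.
have eS k : e k.+1 <= e k by rewrite /= ge_min lexx.
have ele i j : (i <= j)%N -> e j <= e i.
  by move=> ij; apply: (@nonincreasing_seqP _ _ e).1 ij.
exists e, (fun k => N k (e k)); split.
- by move=> k; rewrite e0 (ele 0%N).
- by move=> k; case: (HN k _ (e0 k)).
- by move=> k; case: (HN k _ (e0 k)).
- by move=> k j kj; apply: le_trans (ele _ _ kj) _; rewrite /= ge_min lexx orbT.
Qed.

Definition radius (R : realType) (k : nat) : R := 1 - k.+2%:R^-1.

Lemma radius_gt0 (R : realType) k : 0 < radius R k.
Proof. by rewrite subr_gt0 invf_lt1 ?ltr0n// ltr1n. Qed.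

Lemma radius_lt1 (R : realType) k : radius R k < 1.
Proof. by rewrite ltrBlDr ltrDl invr_gt0 ltr0n. Qed.

Lemma radius_lt (R : realType) j k : (j < k)%N -> radius R j < radius R k.
Proof.
by move=> jk; rewrite ltrD2l ltrN2 ltf_pV2 ?posrE ?ltr0n// ltr_nat.
Qed.

Lemma radius_le (R : realType) j k : (j <= k)%N -> radius R j <= radius R k.
Proof.
by move=> jk; rewrite lerD2l lerN2 lef_pV2 ?posrE ?ltr0n// ler_nat.
Qed.

Lemma radius_sqr_lt (R : realType) (s : R) : s < 1 ->
  exists N, forall k, (N <= k)%N -> s < radius R k ^+ 2.
Proof.
move=> s1; have d0 : 0 < 1 - s by rewrite subr_gt0.
have [N _ HN] := nbhs_infty_gtr (2 / (1 - s)).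
exists N => k Nk; have := HN k Nk.
rewrite ltr_pdivrMr// => h.
have h2 : 2 * k.+2%:R^-1 < 1 - s.
  rewrite ltr_pdivrMr ?ltr0n//; apply: lt_le_trans h _.
  by rewrite mulrC ler_pM2l// ler_nat -addn2 leq_addr.
rewrite /radius; move: (_^-1) h2 => y h2; have := sqr_ge0 y; nra.
Qed.

Definition sqr_radius (R : realType) (k : nat) : R := radius R k ^+ 2.

Lemma sqr_radius_lt1 (R : realType) k : sqr_radius R k < 1.
Proof.
by rewrite /sqr_radius expr_lt1 ?radius_lt1// ltW// radius_gt0.
Qed.

(** The lower bound [z] on the mass is a parameter because it has to be common to
    the two mixtures that are compared later. *)
Lemma mixture_probability (R : realType) (u : nat -> R) (z : R) :
  (forall k, 0 <= u k <= 2^-1 / 2 ^+ k) ->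
  (forall N, exists2 k, (N <= k)%N & 0 < u k) ->
  smooth (mix (sqr_radius R) u) ->
  0 < z -> (z%:E <= \int[lebesgue_measure]_x (mix (sqr_radius R) u x)%:E)%E ->
  exists (mu : probability (measurableTypeR R) R) (Z : R),
    [/\ smooth_unimodal_measure mu, z <= Z <= 2 &
        is_density mu (fun x => Z^-1 * mix (sqr_radius R) u x)].
Proof.
move=> ub u_inf sm z0 zF; set F := mix _ u in sm zF *.
have cF := smooth_continuous sm.
have mF : measurable_fun [set: R] F by exact: continuous_measurable_fun.
have F01 x : 0 <= F x <= 1 by rewrite mix_ge0// mix_le1.
have F0 x : 1 <= (x - 1) ^+ 2 -> F x = 0.
  by move=> x1; apply: mix_eq0 => // k; rewrite (le_trans _ x1)// ltW// sqr_radius_lt1.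
have [Z zZ int1] := normalizing_constant mF F01 F0 z0 zF.
have Z0 : 0 < Z by case/andP: zZ => zZ _; exact: lt_le_trans zZ.
have mf : measurable_fun [set: R] (fun x => Z^-1 * F x).
  by apply: measurable_funM => //; exact: measurable_cst.
have f0 x : 0 <= Z^-1 * F x.
  by case/andP: (F01 x) => Fx _; rewrite mulr_ge0// invr_ge0 ltW.
have [mu mu_f] := exists_density_probability mf f0 int1.
exists mu, Z; split=> //.
apply: (density_smooth_unimodal mu_f).
- by move=> x /F0 ->; rewrite mulr0.
- exact: smoothZ.
apply: unimodal_of_decreasing.
- exact/smooth_continuous/smoothZ.
- by move=> x /F0 ->; rewrite mulr0.
- move=> x /radius_sqr_lt[N HN]; have [k Nk uk] := u_inf N.
  rewrite mulr_gt0 ?invr_gt0//; apply: lt_le_trans (mix_ge_term _ ub k x).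
  by rewrite mulr_gt0// flat_bump_gt0// HN.
- move=> x y yx /radius_sqr_lt[N HN]; have [k Nk uk] := u_inf N.
  rewrite ltr_pM2l ?invr_gt0//; apply: (mix_lt ub yx _ uk).
  by apply: lt_trans yx _; exact: HN.
Qed.

(** * The alternating pair *)

Theorem corollary22 (R : realType) :
  exists mu1 mu2 : probability (measurableTypeR R) R,
    [/\ smooth_unimodal_measure mu1,
        smooth_unimodal_measure mu2,
        ~ tail_le mu1 mu2 &
        ~ tail_le mu2 mu1].
Proof.
have [kappa [kb ksm]] := @smooth_mix R (sqr_radius R) (fun k => ltW (sqr_radius_lt1 R k)).
have k0 k : 0 < kappa k by case/andP: (kb k).
pose r := radius R.
have r01 k : 0 < r k /\ r k < 1 by rewrite radius_gt0 radius_lt1.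
have rS k : r k < r k.+1 by exact: radius_lt.
pose b k := 1 + r k.
(* [b k < a k < a' k < 1 + r k.+1]: the bump [k.+1] is the first one that is
   positive on the segment from [a k] to [a' k], and it is at least its value
   at [a' k] there. *)
pose a k := 1 + (2 * r k + r k.+1) / 3.
pose a' k := 1 + (r k + 2 * r k.+1) / 3.
pose q k := flat_bump (sqr_radius R k.+1) (a' k) * (a' k - a k).
have q0 k : 0 < q k.
  have [] := r01 k; have [] := r01 k.+1; have := rS k => *.
  rewrite mulr_gt0//; first by apply: flat_bump_gt0; rewrite /sqr_radius /a' -/r; nra.
  by rewrite /a' /a; lra.
(* The contribution of the term [0] on the segment from [1] to [1 + r 0 / 2]; both
   mixtures contain this term, so [z] bounds both masses from below. *)
pose z := kappa 0%N * flat_bump (sqr_radius R 0) (1 + r 0%N / 2) * (r 0%N / 2).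
have z0 : 0 < z.
  have [r00 r10] := r01 0%N.
  rewrite !mulr_gt0 ?invr_gt0//.
  by apply: flat_bump_gt0; rewrite /sqr_radius -/r; nra.
have ab k : 0 <= b k < a k.
  have [] := r01 k; have := rS k; rewrite /b /a => *; apply/andP; split; lra.
have s0 k : 0 < kappa k.+1 * q k by rewrite mulr_gt0.
have [e [n [e01 kn bn en]]] := greedy_weights ab s0 z0.
(* The term [k.+1] belongs to the mixture [odd k]. *)
pose u (i : bool) j := if j is k.+1 then
  (if odd k == i then e k * kappa k.+1 else 0) else kappa 0%N.
have uk i j : 0 <= u i j <= kappa j.
  case: j => [|k] /=; first by rewrite lexx ltW.
  case: ifP => _; last by rewrite lexx ltW.
  have /andP[ek0 ek1] := e01 k.
  by rewrite mulr_ge0 ?(ltW ek0) ?(ltW (k0 _))//= ler_piMl// ltW.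
have ub i j : 0 <= u i j <= 2^-1 / 2 ^+ j.
  have /andP[-> /le_trans->//] := uk i j; by case/andP: (kb j).
(* An index of parity [i] beyond [N]. *)
have par (i : bool) N : (N <= N.*2 + i)%N /\ odd (N.*2 + i) = i.
  by rewrite oddD odd_double oddb -addnn -addnA leq_addr.
have u_inf i N : exists2 k, (N <= k)%N & 0 < u i k.
  have [Nk odk] := par i N; exists (N.*2 + i).+1; first exact: leqW.
  by rewrite /u odk eqxx mulr_gt0//; case/andP: (e01 (N.*2 + i)%N).
have zF i : (z%:E <= \int[lebesgue_measure]_x (mix (sqr_radius R) (u i) x)%:E)%E.
  have [r00 r10] := r01 0%N.
  rewrite /z -[X in _ * X](addrK 1) [_ + 1]addrC.
  have cm := smooth_continuous (ksm _ (uk i)).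
  apply: integral_ge_itv => //.
  - exact: continuous_measurable_fun.
  - by move=> x; exact: mix_ge0.
  - by rewrite mulr_ge0 ?flat_bump_ge0// ltW.
  - by rewrite lerDl; lra.
  - move=> x /andP[x1 x2]; apply: le_trans (mix_ge_term _ (ub i) 0 x).
    by rewrite ler_wpM2l ?(ltW (k0 _))// flat_bump_le//; nra.
have [mu Hmu] := choice (fun i => mixture_probability (ub i) (u_inf i) (ksm _ (uk i)) z0 (zF i)).
have key i k : odd k = i -> (moment (mu (~~ i)) (n k) < moment (mu i) (n k))%E.
  move=> odk.
  have [Z [_ /andP[zZ Z2] D]] := Hmu i.
  have [Z' [_ /andP[zZ' Z2'] D']] := Hmu (~~ i).
  have Z0 : 0 < Z by exact: lt_le_trans zZ.
  have Z0' : 0 < Z' by exact: lt_le_trans zZ'.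
  have [rk0 rk1] := r01 k; have rSk := rS k; have [_ rk2] := r01 k.+1.
  have /andP[ek0 ek1] := e01 k.
  (* [eps] bounds the mixture [~~ i] beyond [b k], before normalization. *)
  set eps := a k ^+ n k * (e k * (kappa k.+1 * q k)) * z / 8 / 2 ^+ n k.
  have eps0 : 0 < eps.
    have ak0 : 0 < a k by have /andP[b0] := ab k; exact: le_lt_trans.
    apply: divr_gt0; last exact: exprn_gt0.
    apply: divr_gt0 => //; apply: mulr_gt0 => //.
    by apply: mulr_gt0; [exact: exprn_gt0|exact: mulr_gt0].
  apply: (moment_lt (a := a k) (a' := a' k) (b := b k)
    (c := Z^-1 * (e k * kappa k.+1 * flat_bump (sqr_radius R k.+1) (a' k)))
    (eps := Z'^-1 * eps) D D').
  - move=> x x1; rewrite mix_eq0 ?mulr0// => j.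
    by rewrite (le_trans _ x1)// ltW// sqr_radius_lt1.
  - by rewrite /a; lra.
  - by rewrite /a /a'; lra.
  - by rewrite !mulr_ge0 ?invr_ge0 ?flat_bump_ge0// ltW.
  - move=> x /andP[ax xa]; rewrite ler_wpM2l ?invr_ge0 ?(ltW Z0)//.
    apply: le_trans (mix_ge_term _ (ub i) k.+1 x).
    rewrite /u odk eqxx ler_wpM2l ?mulr_ge0 ?(ltW ek0) ?(ltW (k0 _))//.
    by apply: flat_bump_le; move: ax xa; rewrite /a /a'; nra.
  - by rewrite /b; apply/andP; split; lra.
  - move=> x bx; rewrite ler_wpM2l ?invr_ge0 ?(ltW Z0')//.
    apply: (mix_term_le (ub (~~ i)) _).2 => j.
    (* Terms up to [k] vanish beyond [b k], the term [k.+1] belongs to the other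
       mixture, and the later ones are capped. *)
    have [jk|kj] := leqP j k.
      rewrite flat_bump_eq0.
        by rewrite mulr0 mulr_ge0 ?(ltW eps0)// divr_ge0 ?exprn_ge0.
      have rjk : r j <= r k := radius_le R jk; have [rj0 _] := r01 j.
      by rewrite /b in bx; rewrite /sqr_radius -/r lerXn2r ?nnegrE; lra.
    case: j kj => // j; rewrite ltnS => kj /=.
    move: kj; rewrite leq_eqVlt => /orP[/eqP <-|kj].
      by rewrite odk; case: (i); rewrite /= mul0r mulr_ge0 ?(ltW eps0)// divr_ge0.
    case: ifP => _; last by rewrite mul0r mulr_ge0 ?(ltW eps0)// divr_ge0.
    rewrite -mulrA; apply: ler_pM; [|by rewrite mulr_ge0 ?flat_bump_ge0// ltW|exact: en|].
      by case/andP: (e01 j) => /ltW.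
    case/andP: (kb j.+1) => _; apply: le_trans.
    by rewrite ler_piMr ?flat_bump_le1// ltW.
  (* With [T = a^n * (e * (kappa * q))]: the left-hand side is less than [T / 4 + T / 8], as
     [z / Z' <= 1] and [2 - b k <= 1]; the right-hand side is at least [T / 2], as
     [Z <= 2]. *)
  - set T := a k ^+ n k * (e k * (kappa k.+1 * q k)) in bn eps eps0 *.
    have -> : a k ^+ n k * (Z^-1 * (e k * kappa k.+1 *
        flat_bump (sqr_radius R k.+1) (a' k)) * (a' k - a k)) = Z^-1 * T.
      rewrite /T /q; ring.
    have T0 : 0 < T.
      have ak0 : 0 < a k by have /andP[b0] := ab k; exact: le_lt_trans.
      by apply: mulr_gt0; [exact: exprn_gt0|exact: mulr_gt0].
    have -> : 2 ^+ n k * (Z'^-1 * eps * (2 - b k)) = (Z'^-1 * z) * (2 - b k) * (T / 8).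
      have p2 : (2 : R) ^+ n k != 0 by rewrite expf_neq0.
      have Zn : Z' != 0 by rewrite gt_eqF.
      rewrite /eps; field; by rewrite p2 Zn.
    have h1 : Z'^-1 * z <= 1 by rewrite mulrC ler_pdivrMr// mul1r.
    have h10 : 0 <= Z'^-1 * z by rewrite mulr_ge0 ?invr_ge0// ltW.
    have h2 : T / 2 <= Z^-1 * T by rewrite mulrC ler_pM2r// lef_pV2 ?posrE.
    have h3 : 0 <= 2 - b k <= 1 by rewrite /b; apply/andP; split; lra.
    have h4 : (Z'^-1 * z) * (2 - b k) <= 1.
      by case/andP: h3 => *; rewrite mulr_ile1.
    have h5 : (Z'^-1 * z) * (2 - b k) * (T / 8) <= T / 8.
      by rewrite ler_piMl// divr_ge0// ltW.
    have := bn k; rewrite -/T; lra.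
exists (mu true), (mu false); split.
- by have [Z []] := Hmu true.
- by have [Z []] := Hmu false.
- move=> [n0 H]; have [n0k odk] := par true n0.
  have := key true _ odk; rewrite ltNge => /negP; apply; apply: H.
  exact: leq_trans n0k (kn _).
- move=> [n0 H]; have [n0k odk] := par false n0.
  have := key false _ odk; rewrite ltNge => /negP; apply; apply: H.
  exact: leq_trans n0k (kn _).
Qed.
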